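(* Let $A\in\mathscr R$ be a fixed set, let $\mathbf X=(X_1,\ldots,X_d)^\top$ be a random vector in $[0,\infty)^d$ with distribution $F\in\mathcal D_A$, and let $\mathbf\Theta=(\Theta_1,\ldots,\Theta_d)^\top$ be a random vector in $[0,\infty)^d$ none of whose components is degenerate at zero. Suppose $\mathbf\Theta$ and $\mathbf X$ are independent and that, for some $p>J^+_{F_A}$, $\mathbf E[\Theta_i^p]<\infty$ for all $i=1,\ldots,d$. Let $H$ be the distribution of the componentwise product $\mathbf\Theta\mathbf X=(\Theta_1X_1,\ldots,\Theta_dX_d)^\top$. Then $H\in\mathcal D_A$ and $$H(xA)\asymp F(xA),\qquad x\to\infty.$$
   Context: Fix an integer $d\ge 1$. $\mathscr R$ is the family of nonempty sets $A\subsetneq\mathbb R^d$ that are open, increasing (if $\mathbf x\in A$ and $\mathbf a\in[0,\infty)^d$ then $\mathbf x+\mathbf a\in A$), have convex complement $A^c$, and satisfy $\mathbf 0\notin\overline A$ (closure). For a random vector $\mathbf X$ in $[0,\infty)^d$ with distribution $F$ write $F(xA):=\mathbf P[\mathbf X\in xA]$, put $Y_A:=\sup\{u>0:\mathbf X\in uA\}$ (with $\sup\emptyset=0$), and let $F_A$ be the distribution of $Y_A$; its tail is $\overline F_A(x)=\mathbf P[Y_A>x]=\mathbf P[\mathbf X\in xA]$ for $x>0$. The same notation applies to any other random vector, so $H(xA)=\mathbf P[\mathbf\Theta\mathbf X\in xA]$. For a distribution $V$ on $[0,\infty)$ write $\overline V=1-V$ and assume $\overline V(x)>0$ for all $x\ge0$.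 $V\in\mathcal D$ (dominatedly varying) if $\limsup_{x\to\infty}\overline V(bx)/\overline V(x)<\infty$ for every (equivalently, some) $b\in(0,1)$. $F\in\mathcal D_A$ means $F_A\in\mathcal D$. The upper Matuszewska index is $J_V^+:=-\lim_{v\to\infty}\frac{\log\overline V_*(v)}{\log v}$ with $\overline V_*(v):=\liminf_{x\to\infty}\overline V(vx)/\overline V(x)$ (it is finite iff $V\in\mathcal D$). $f\asymp g$ means $f=O(g)$ and $g=O(f)$ as $x\to\infty$. *)

(* Defs.v *)
From HB Require Import structures.
From mathcomp Require Import all_boot all_order all_algebra.
From mathcomp Require Import all_classical all_reals all_analysis.

Set Implicit Arguments.
Unset Strict Implicit.
Unset Printing Implicit Defensive.

Import Order.TTheory GRing.Theory Num.Theory.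
Import numFieldNormedType.Exports.

Local Open Scope classical_set_scope.
Local Open Scope ring_scope.

(* R^d with its Borel sigma-algebra; convertible to 'rV[R]_d. *)
Notation rvec R d := (g_sigma_algebraType (@open 'rV[R]_d)).

Definition nonneg_vec (R : realType) (d : nat) (x : 'rV[R]_d) : Prop :=
  forall i, 0 <= x ord0 i.

Definition scale_set (R : realType) (d : nat) (u : R) (A : set 'rV[R]_d) :
    set 'rV[R]_d :=
  [set u *: a | a in A].

Record in_scrR (R : realType) (d : nat) (A : set 'rV[R]_d) : Prop := InScrR {
  scrR_nonempty : A !=set0 ;
  scrR_proper : A <> setT ;
  scrR_open : open A ;
  scrR_increasing :
    forall x a : 'rV[R]_d, A x -> nonneg_vec a -> A (x + a) ;
  scrR_convexC : convex_set (~` A) ;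
  scrR_notin0 : ~ closure A 0 }.

(* For A in the family above and y in [0,oo)^d the set is bounded, so that
   [sup] is the genuine supremum; [sup set0 = 0]. *)
Definition Yfun (R : realType) (d : nat) (A : set 'rV[R]_d) (y : 'rV[R]_d) : R :=
  sup [set u : R | 0 < u /\ scale_set u A y].

Definition law_along (R : realType) (d : nat) (A : set 'rV[R]_d)
    (F : set (rvec R d) -> \bar R) : set R -> \bar R :=
  pushforward F (Yfun A : rvec R d -> R).

Definition tail (R : realType) (V : set R -> \bar R) (x : R) : R :=
  fine (V `]x, +oo[%classic).

Definition dominatedly_varying (R : realType) (V : set R -> \bar R) : Prop :=
  (forall x : R, 0 <= x -> 0 < tail V x) /\
  (forall b : R, 0 < b < 1 ->
    (limf_esup (fun x : R => (tail V (b * x) / tail V x)%:E) +oo%R < +oo)%E).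

Definition dominatedly_varying_along (R : realType) (d : nat)
    (A : set 'rV[R]_d) (F : set (rvec R d) -> \bar R) : Prop :=
  dominatedly_varying (law_along A F).

Definition tail_lower (R : realType) (V : set R -> \bar R) (v : R) : \bar R :=
  limf_einf (fun x : R => (tail V (v * x) / tail V x)%:E) +oo%R.

(* Extended-real valued: [lne 0 = -oo], so the index is +oo when
   [tail_lower V] vanishes for large [v]. *)
Definition upper_Matuszewska (R : realType) (V : set R -> \bar R) : \bar R :=
  (- lim ((lne (tail_lower V v) * ((ln v)^-1)%:E) @[v --> +oo%R]))%E.

Definition independent_rv (d1 d2 d3 : measure_display) (T : measurableType d1)
    (T1 : measurableType d2) (T2 : measurableType d3) (R : realType)
    (P : probability T R) (X : T -> T1) (Y : T -> T2) : Prop :=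
  forall (B : set T1) (C : set T2), measurable B -> measurable C ->
    P (X @^-1` B `&` Y @^-1` C) = (P (X @^-1` B) * P (Y @^-1` C))%E.

Definition vprod (R : realType) (d : nat) (a b : 'rV[R]_d) : 'rV[R]_d :=
  \row_i (a ord0 i * b ord0 i).

(* The library has no canonical [filter_on] packing of [+oo], which the Landau
   notation [=O_] expects. *)
Definition at_pinfty (R : realType) : filter_on R :=
  FilterType (pinfty_nbhs R) proper_pinfty_nbhs.

Definition asymp_equiv (R : realType) (f g : R -> R) : Prop :=
  (f =O_ (at_pinfty R) g) /\ (g =O_ (at_pinfty R) f).

(* Main.v *)
Require Import Defs.
From HB Require Import structures.
From mathcomp Require Import all_boot all_order all_algebra.
From mathcomp Require Import all_classical all_reals all_analysis.
From mathcomp Require Import measurable_realfun ring lra.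

Set Implicit Arguments.
Unset Strict Implicit.
Unset Printing Implicit Defensive.

Import Order.TTheory GRing.Theory Num.Theory.
Import numFieldNormedType.Exports.

Local Open Scope classical_set_scope.
Local Open Scope ring_scope.

(** Write F(x) and H(x) for the probabilities that X, respectively the
    componentwise product Theta X, lies in xA; these are the tails of Y_A.

    Upper bound.  A is increasing, so Theta X in xA and max_i Theta_i <= s
    force s X in xA, that is X in (x/s)A; in particular the event max_i Theta_i <= 1
    contributes at most F(x).  An upper Matuszewska index below p
    gives constants v > 1 and rho < v^p with F(x) <= rho F(vx) for x >= x0
    ([upper_Matuszewska_lt]).  Cut according to the layer
    v^k < max_i Theta_i <= v^(k+1) for k < K, where v^K is comparable to x.
    By independence, Markov's inequality with the p-th moment and iteration of
    F(x/v) <= rho F(x), layer k contributes at most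
    m v^(-pk) rho^(k+1) F(x): a convergent geometric series times F(x)
    ([pr_vprod_layers]).  The remaining event max_i Theta_i > v^K has
    probability at most m v^(-pK) <= m rho^(-K), and rho^(-K) = O(F(x)) because
    F(x/v^K) <= rho^K F(x) while x/v^K stays bounded ([vprod_tail_upper]).

    Lower bound.  Each component of Theta is positive with positive probability,
    but two components need never be positive together, so one axis has to be
    used at a time.  This is where convexity of the complement enters: if
    y is in A, then d y_i e_i is in A for some i, since y is the mean of the
    points d y_i e_i ([scrR_coordinate]).  Hence F(x) is at most the sum over i
    of the probabilities of d X_i e_i in xA, and on the independent event
    Theta_i > e each of these gives Theta X in (e/d)xA.  So
    c F(x) <= H(bx) with b = e/d < 1 ([vprod_tail_lower]), and dominated
    variation of F absorbs the factor b.

    The two bounds are the asymptotic equivalence, and dominated variation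
    passes from F to H through it.

    Two points of rigour take some room.  The index is defined by a limit,
    whose existence has to be proved before its value can be used; this is a
    Fekete-type argument ([Matuszewska_cvg]).  And Theta X in xA has to be an
    event: the Borel sets of R^d come from open sets, so the preimage of an
    open set is written as a countable union of rational boxes
    ([measurable_preimage_open]). *)

(** * Limits superior and inferior at infinity *)

Lemma limf_esup_pinfty_lt (R : realType) (f : R -> \bar R) (c : \bar R) :
  (limf_esup f +oo%R < c)%E -> \forall x \near +oo, (f x < c)%E.
Proof.
rewrite limf_esupE => /ereal_inf_lt[_ [B FB <-]] supB.
apply: filterS FB => x Bx; apply: le_lt_trans supB.
by apply: ereal_sup_ubound; exists x.
Qed.

Lemma limf_esup_pinfty_le (R : realType) (f : R -> \bar R) (c : \bar R) :
  (\forall x \near +oo, (f x <= c)%E) -> (limf_esup f +oo%R <= c)%E.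
Proof.
move=> fc; rewrite limf_esupE; apply: ge_ereal_inf.
exists (ereal_sup (f @` [set x | f x <= c]%E)); first by exists [set x | f x <= c]%E.
by apply: ge_ereal_sup => _ [x fxc <-].
Qed.

Lemma limf_einf_pinfty_gt (R : realType) (f : R -> \bar R) (c : \bar R) :
  (c < limf_einf f +oo%R)%E -> \forall x \near +oo, (c < f x)%E.
Proof.
rewrite limf_einfE => /ereal_sup_gt[_ [B FB <-]] infB.
apply: filterS FB => x Bx; apply: lt_le_trans infB _.
by apply: ereal_inf_lbound; exists x.
Qed.

Lemma limf_einf_pinfty_ge (R : realType) (f : R -> \bar R) (c : \bar R) :
  (\forall x \near +oo, (c <= f x)%E) -> (c <= limf_einf f +oo%R)%E.
Proof.
move=> fc; rewrite limf_einfE; apply: le_ereal_sup_tmp.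
exists (ereal_inf (f @` [set x | c <= f x]%E)); first by exists [set x | c <= f x]%E.
by apply: le_ereal_inf_tmp => _ [x fxc <-].
Qed.

Lemma near_pinfty_scale (R : realType) (v : R) (Q : R -> Prop) : 0 < v ->
  (\forall x \near +oo, Q x) -> \forall x \near +oo, Q (v * x).
Proof.
move=> v0 [M [_ QM]]; near=> x; apply: QM.
rewrite mulrC -ltr_pdivrMr//.
by near: x; apply: nbhs_pinfty_gt; rewrite num_real.
Unshelve. all: by end_near. Qed.

(** The last step of Fekete's lemma, in extended reals: a function is below its
    supremum, so an eventual lower bound by every c below the supremum is enough
    for convergence. *)
Lemma cvg_pinfty_ereal_sup (R : realType) (G : R -> \bar R) (a : R) :
  let S := ereal_sup [set G v | v in [set v | a < v]] in
  (S < +oo)%E ->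
  (forall c : R, (c%:E < S)%E -> \forall v \near +oo, (c%:E <= G v)%E) ->
  G v @[v --> +oo%R] --> S.
Proof.
move=> S Soo low.
have up : \forall v \near +oo%R, (G v <= S)%E.
  near=> v; apply: ereal_sup_ubound; exists v => //=.
  by near: v; apply: nbhs_pinfty_gt; rewrite num_real.
move: up low Soo; case: S => [r| |] // up low _; last first.
  apply/cvgeNyPle => B; apply: filterS up => v; rewrite leeNy_eq => /eqP ->.
  exact: leNye.
have fin c : c < r -> \forall v \near +oo%R, (c%:E <= G v <= r%:E)%E.
  move=> cr; near=> v; apply/andP; split; near: v => //.
  by apply: low; rewrite lte_fin.
apply/fine_cvgP; split.
  have := fin (r - 1); rewrite ltrBlDr ltrDl => /(_ ltr01).
  by apply: filterS => v /andP[]; case: (G v).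
apply/cvgrPdist_le => e e0; have := fin (r - e); rewrite ltrBlDr ltrDl => /(_ e0).
apply: filterS => v /andP[] /=; case: (G v) => //= g; rewrite !lee_fin => l u.
by rewrite ger0_norm ?subr_ge0//; lra.
Unshelve. all: by end_near. Qed.

(** * Dominated variation and the upper Matuszewska index *)

Lemma exists_expn_bracket (R : realType) (v y : R) : 1 < v -> 1 <= y ->
  exists n, v ^+ n <= y < v ^+ n.+1.
Proof.
move=> v1 y1; have v0 : 0 < v by apply: lt_trans v1.
have y0 : 0 < y by apply: lt_le_trans y1.
have lv : 0 < ln v by rewrite ln_gt0.
have /truncn_itv/andP[] : 0 <= ln y / ln v by rewrite divr_ge0// ?ln_ge0// ltW.
rewrite ler_pdivlMr// ltr_pdivrMr// !mulr_natl -!lnXn//.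
rewrite ler_ln ?posrE ?exprn_gt0// ltr_ln ?posrE ?exprn_gt0// => lo hi.
by exists (Num.trunc (ln y / ln v)); rewrite lo hi.
Qed.

Section matuszewska.
Variables (R : realType) (V : set R -> \bar R).
Hypothesis V_gt0 : forall x : R, 0 <= x -> 0 < tail V x.
Hypothesis V_noninc : forall x y : R, 0 <= x -> x <= y -> tail V y <= tail V x.

(* The quantity whose limit at infinity is minus the upper index. *)
Let G (v : R) : \bar R := (lne (tail_lower V v) * ((ln v)^-1)%:E)%E.

(** The index only enters through comparisons of tail V (v x) with
    v ^ c * tail V x for large x.  The exponent is raised to some c' > c since
    the inequality c < G v between limits leaves room for it; the gain is what
    makes the strict inequality with p usable later. *)
Lemma Matuszewska_rate_gt (c v : R) : 1 < v -> (c%:E < G v)%E ->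
  exists2 c' : R, c < c' &
    \forall x \near +oo, v `^ c' * tail V x <= tail V (v * x).
Proof.
move=> v1; have v0 : 0 < v by apply: lt_trans v1.
have lnv : 0 < ln v by rewrite ln_gt0.
have rate (s : R) : (s%:E < tail_lower V v)%E ->
    \forall x \near +oo, s * tail V x <= tail V (v * x).
  move=> /limf_einf_pinfty_gt near_s; near=> x.
  have x0 : 0 <= x by near: x; apply: nbhs_pinfty_ge; rewrite num_real.
  rewrite -ler_pdivlMr ?V_gt0//; apply: ltW; rewrite -lte_fin.
  by near: x.
have low_le1 : (tail_lower V v <= 1)%E.
  rewrite leNgt; apply/negP => /limf_einf_pinfty_gt near1.
  have [x] : exists x : R, (1 < (tail V (v * x) / tail V x)%:E)%E /\ 0 <= x.
    apply: (@filter_ex _ (+oo%R : set_system R)); near=> x; split; first by near: x.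
    by near: x; apply: nbhs_pinfty_ge; rewrite num_real.
  rewrite lte_fin => -[+ x0]; rewrite ltr_pdivlMr ?V_gt0// mul1r.
  by apply/negP; rewrite -leNgt V_noninc// ler_peMl// ltW.
rewrite /G; move: rate low_le1; case: (tail_lower V v) => [r| |]//= rate _;
  last by rewrite gt0_mulNye// lte_fin invr_gt0.
case: ifPn => [_|]; first by rewrite gt0_mulNye// lte_fin invr_gt0.
rewrite -ltNge => r0; rewrite -EFinM lte_fin => /midf_lt[cr rc].
exists ((c + ln r / ln v) / 2) => //.
apply: rate; rewrite lte_fin -ltr_ln ?posrE ?powR_gt0// ln_powR.
by rewrite -ltr_pdivlMr.
Unshelve. all: by end_near. Qed.

Lemma Matuszewska_rate_ge (c v : R) : 1 < v ->
  (\forall x \near +oo, v `^ c * tail V x <= tail V (v * x)) -> (c%:E <= G v)%E.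
Proof.
move=> v1 rate; have v0 : 0 < v by apply: lt_trans v1.
have lnv : 0 < ln v by rewrite ln_gt0.
have : ((v `^ c)%:E <= tail_lower V v)%E.
  apply: limf_einf_pinfty_ge; near=> x.
  have x0 : 0 <= x by near: x; apply: nbhs_pinfty_ge; rewrite num_real.
  rewrite lee_fin ler_pdivlMr ?V_gt0//.
  by near: x.
rewrite /G; case: (tail_lower V v) => [r| |]//=; last first.
  by rewrite gt0_mulye ?leey// lte_fin invr_gt0.
rewrite lee_fin => cr; have r0 : 0 < r by apply: lt_le_trans cr; rewrite powR_gt0.
rewrite (lt_geF r0) -EFinM lee_fin ler_pdivlMr// -ln_powR ler_ln// posrE//.
exact: powR_gt0.
Unshelve. all: by end_near. Qed.

Lemma Matuszewska_rate_iter (v r : R) : 0 < v -> 0 <= r ->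
  (\forall x \near +oo, r * tail V x <= tail V (v * x)) ->
  forall n, \forall x \near +oo, r ^+ n * tail V x <= tail V (v ^+ n * x).
Proof.
move=> v0 r0 rate; elim=> [|n IHn]; first by near=> x; rewrite !expr0 !mul1r.
have vn0 : 0 < v ^+ n by rewrite exprn_gt0.
have step := near_pinfty_scale vn0 rate.
near=> x; rewrite 2!exprS -2!mulrA.
apply: le_trans (_ : r * tail V (v ^+ n * x) <= _); last by near: x.
by rewrite ler_wpM2l//; near: x.
Unshelve. all: by end_near. Qed.

(** A rate with positive exponent would make the tail increase. *)
Lemma Matuszewska_rate_le0 (c v : R) : 1 < v ->
  (\forall x \near +oo, v `^ c * tail V x <= tail V (v * x)) -> c <= 0.
Proof.
move=> v1 rate; have v0 : 0 < v by apply: lt_trans v1.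
rewrite leNgt; apply/negP => c0.
have [x [x0 ratex]] : exists x : R,
    0 <= x /\ v `^ c * tail V x <= tail V (v * x).
  apply: (@filter_ex _ (+oo%R : set_system R)); near=> x; split; last by near: x.
  by near: x; apply: nbhs_pinfty_ge; rewrite num_real.
have := le_trans ratex (V_noninc x0 (ler_peMl x0 (ltW v1))).
rewrite -[leRHS]mul1r ler_pM2r ?V_gt0//; apply/negP.
by rewrite -ltNge -ltr_ln ?posrE ?powR_gt0// ln1 ln_powR mulr_gt0 ?ln_gt0.
Unshelve. all: by end_near. Qed.

(** Fekete's argument.  If the exponent c is a rate for v0, iterating it n+1
    times along v0 ^ n <= v < v0 ^ (n+1) and using monotonicity between powers
    loses only the factor v0 ^ c, which a slightly smaller exponent c0 < c
    absorbs once v is large. *)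
Lemma Matuszewska_cvg :
  G v @[v --> +oo%R] --> ereal_sup [set G v | v in [set v | 1 < v]].
Proof.
apply: cvg_pinfty_ereal_sup.
  apply: (@le_lt_trans _ _ 0%E) => //; apply: ge_ereal_sup => _ [v /= v1 <-].
  rewrite leNgt; apply/negP => /(Matuszewska_rate_gt v1)[c c0].
  by move/(Matuszewska_rate_le0 v1); rewrite leNgt c0.
move=> c0 /ereal_sup_gt[_ [v0 /= v01 <-]] /(Matuszewska_rate_gt v01)[c c0c rate].
have cle0 := Matuszewska_rate_le0 v01 rate.
have v0_gt0 : 0 < v0 by apply: lt_trans v01.
have l0 : 0 < ln v0 by rewrite ln_gt0.
near=> v.
have v1 : 1 < v by near: v; apply: nbhs_pinfty_gt; rewrite num_real.
have v_gt0 : 0 < v by apply: lt_trans v1.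
apply: Matuszewska_rate_ge => //.
have lv0 : 0 < ln v by rewrite ln_gt0.
(* This threshold on v makes c (ln v + ln v0) >= c0 ln v. *)
have lnv : (- c * ln v0) / (c - c0) <= ln v.
  by rewrite -ler_expR (@lnK _ v) ?posrE.
have [n /andP[nlo /ltW vle]] := exists_expn_bracket v01 (ltW v1).
rewrite -ler_ln ?posrE ?exprn_gt0// lnXn// -mulr_natl in nlo.
have pow : v `^ c0 <= (v0 `^ c) ^+ n.+1.
  rewrite -ler_ln ?posrE ?exprn_gt0 ?powR_gt0// lnXn ?powR_gt0// !ln_powR.
  rewrite -mulr_natl.
  rewrite ler_pdivrMr ?subr_gt0// in lnv.
  have : c * (n%:R * ln v0) >= c * ln v by rewrite ler_wnM2l.
  rewrite -[n.+1%:R]natr1; nra.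
have := Matuszewska_rate_iter v0_gt0 (powR_ge0 _ _) rate n.+1 => iter.
near=> x.
have x0 : 0 <= x by near: x; apply: nbhs_pinfty_ge; rewrite num_real.
apply: (@le_trans _ _ ((v0 `^ c) ^+ n.+1 * tail V x)).
  by rewrite ler_wpM2r// ltW ?V_gt0.
apply: (@le_trans _ _ (tail V (v0 ^+ n.+1 * x))); first by near: x.
by rewrite V_noninc ?ler_wpM2r// mulr_ge0// ltW.
Unshelve. all: by end_near. Qed.

(** What the hypothesis on the index is used for: over the single ratio v the
    tail loses at most a factor rho that is strictly smaller than v ^ p, so the
    moment of order p beats it geometrically. *)
Lemma upper_Matuszewska_lt (p : R) : (upper_Matuszewska V < p%:E)%E ->
  exists v rho x0 : R, [/\ 1 < v, 1 <= rho, rho < v `^ p, 0 < x0 &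
    forall x, x0 <= x -> tail V x <= rho * tail V (v * x)].
Proof.
rewrite /upper_Matuszewska (cvg_lim _ Matuszewska_cvg)//.
rewrite lteNl => /ereal_sup_gt[_ [v /= v1 <-]] /(Matuszewska_rate_gt v1)[c pc rate].
have c0 := Matuszewska_rate_le0 v1 rate.
have v0 : 0 < v by apply: lt_trans v1.
have lv : 0 < ln v by rewrite ln_gt0.
have [M [_ HM]] := rate.
exists v, (v `^ (- c)), (Num.max M 0 + 1); split=> //.
- rewrite -ler_ln ?posrE ?powR_gt0// ln1 ln_powR mulr_ge0 ?oppr_ge0//.
  exact: ltW.
- by rewrite -ltr_ln ?posrE ?powR_gt0// !ln_powR ltr_pM2r//; lra.
- by rewrite ltr_pwDr// le_max lexx orbT.
- move=> x xM; rewrite powRN mulrC ler_pdivlMr ?powR_gt0// mulrC; apply: HM.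
  by apply: lt_le_trans xM; rewrite ltr_pwDr// le_max lexx.
Qed.

End matuszewska.

Lemma tail_ratio_iter (R : realType) (f : R -> R) (v rho x0 x : R) (k : nat) :
  1 < v -> 0 <= rho -> 0 < x0 -> (forall y, x0 <= y -> f y <= rho * f (v * y)) ->
  x0 * v ^+ k <= x -> f (x / v ^+ k) <= rho ^+ k * f x.
Proof.
move=> v1 rho0 x00 fD; have v0 : 0 < v by apply: lt_trans v1.
elim: k => [|k IHk] kx; first by rewrite !expr0 divr1 mul1r.
have := fD (x / v ^+ k.+1); rewrite ler_pdivlMr ?exprn_gt0// => /(_ kx) /le_trans.
apply; rewrite (exprS rho) -mulrA ler_wpM2l//.
have -> : v * (x / v ^+ k.+1) = x / v ^+ k.
  have : v ^+ k != 0 by rewrite gt_eqF// exprn_gt0.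
  by rewrite exprS => vk; field; rewrite vk gt_eqF.
apply: IHk; apply: le_trans kx.
by rewrite ler_pM2l// exprS ler_peMl ?ltW// exprn_gt0.
Qed.

Lemma dominatedly_varying_ratio (R : realType) (V : set R -> \bar R) (b : R) :
  dominatedly_varying V -> 0 < b < 1 ->
  exists2 M : R, 0 < M & \forall x \near +oo, tail V (b * x) <= M * tail V x.
Proof.
move=> [V0 VD] b01; have b0 : 0 < b by case/andP: b01.
have [M M0 limM] : exists2 M : R, 0 < M &
    (limf_esup (fun x : R => (tail V (b * x) / tail V x)%:E) +oo%R < M%:E)%E.
  have := VD _ b01; case: limf_esup => // [r _|_]; last by exists 1 => //; rewrite ltNyr.
  by exists (Num.max r 0 + 1); [rewrite ltr_pwDr// le_max lexx orbT
                               |rewrite lte_fin ltr_pwDr// le_max lexx].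
exists M => //; have nearM := limf_esup_pinfty_lt limM; near=> x.
have x0 : 0 <= x by near: x; apply: nbhs_pinfty_ge; rewrite num_real.
rewrite -ler_pdivrMr ?V0//; apply: ltW; rewrite -lte_fin.
by near: x.
Unshelve. all: by end_near. Qed.

(** * The geometry of sets with convex complement *)

Lemma convex_set_mean (R : realType) (E : lmodType R) (C : set E) (n : nat)
    (z : 'I_n.+1 -> E) :
  convex_set C -> (forall i, C (z i)) -> C (n.+1%:R^-1 *: \sum_i z i).
Proof.
move=> cC; elim: n z => [|n IHn] z Cz; first by rewrite big_ord1 invr1 scale1r.
have n1 : (n.+2%:R : R)^-1 <= 1 by rewrite invf_le1 ?ler1n ?ltr0n.
have n0 : 0 <= (n.+2%:R : R)^-1 by rewrite invr_ge0.
pose t : {i01 R} := Itv01 n0 n1.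
have /mem_set Cn : C (n.+1%:R^-1 *: \sum_i z (widen_ord (leqnSn _) i)).
  by apply: IHn => i; exact: Cz.
have := cC _ _ t (mem_set (Cz ord_max)) Cn => /set_mem.
have eqn : (1 - (n.+2%:R : R)^-1) * n.+1%:R^-1 = n.+2%:R^-1.
  have : (n.+2%:R : R) != 0 by rewrite pnatr_eq0.
  have : (n.+1%:R : R) != 0 by rewrite pnatr_eq0.
  by rewrite -[n.+2%:R]natr1; move: n.+1%:R => k k0 k1; field; rewrite k0 k1.
rewrite /conv /= scalerA /unstable.onem eqn.
by rewrite [in X in _ -> X]big_ord_recr /= [in X in _ -> X]scalerDr addrC.
Qed.

Section scrR_geometry.
Variables (R : realType) (d : nat) (A : set 'rV[R]_d).
Hypothesis hA : in_scrR A.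
Implicit Types (x y : 'rV[R]_d) (u w : R).

Lemma scale_setE u y : 0 < u -> scale_set u A y = A (u^-1 *: y).
Proof.
move=> u0; have un0 : u != 0 by rewrite gt_eqF.
apply/propext; split=> [[a Aa <-]|Ay]; first by rewrite scalerK.
by exists (u^-1 *: y) => //; rewrite scalerKV.
Qed.

Lemma scrR_le x y : A x -> (forall i, x ord0 i <= y ord0 i) -> A y.
Proof.
move=> Ax xy; rewrite -(subrK x y) addrC; apply: scrR_increasing => // i.
by rewrite !mxE subr_ge0.
Qed.

Lemma scrR_scale_le u w y : nonneg_vec y -> u <= w -> A (u *: y) -> A (w *: y).
Proof.
move=> y0 uw Auy; apply: scrR_le Auy _ => i.
by rewrite !mxE ler_wpM2r.
Qed.

(** Boundedness of the set whose supremum is Y_A: points of A stay away from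
    the origin, so y / u cannot be in A for large u. *)
Lemma scrR_scale_bounded y : exists2 r : R, 0 < r & forall u, A (u^-1 *: y) -> u <= r.
Proof.
have /existsNP[B /not_implyP[/nbhs_ballP[e /= e0 eB] AB]] := scrR_notin0 hA.
exists (`|y| / e + 1) => [|u Auy]; first by rewrite ltr_wpDl// divr_ge0// ltW.
have [u0|u0] := leP u 0; first by rewrite (le_trans u0)// addr_ge0// divr_ge0// ltW.
rewrite ler_wpDr// ler_pdivlMr// leNgt; apply/negP => yue; apply: AB.
exists (u^-1 *: y); split=> //; apply: eB; rewrite -ball_normE /= sub0r normrN.
by rewrite normrZ gtr0_norm ?invr_gt0// mulrC ltr_pdivrMr// mulrC.
Qed.

Lemma Yfun_gt u y : 0 <= u -> nonneg_vec y ->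
  u < Yfun A y <-> exists2 w, u < w & A (w^-1 *: y).
Proof.
move=> u0 y0; rewrite /Yfun; set S := [set _ | _].
have [r r0 Sr] := scrR_scale_bounded y.
split=> [uS|[w uw Aw]].
  have [S0|/set0P S0] := eqVneq S set0.
    by move: uS; rewrite S0 sup0 ltNge u0.
  have [w [w0 wA] uw] := sup_gt S0 uS.
  by exists w => //; rewrite -scale_setE.
have Sub : has_ubound S by exists r => v [v0]; rewrite scale_setE// => /Sr.
have w0 : 0 < w by apply: le_lt_trans uw.
by apply: lt_le_trans uw _; apply: ub_le_sup => //; split=> //; rewrite scale_setE.
Qed.

(** Since A is open, the supremum defining Y_A is not attained: y in uA leaves
    room for a strictly larger scaling factor. *)
Lemma Yfun_gt_scale u y : 0 < u -> nonneg_vec y ->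
  u < Yfun A y <-> A (u^-1 *: y).
Proof.
move=> u0 y0; rewrite Yfun_gt//; last exact: ltW.
split=> [[w uw]|Au].
  by apply: scrR_scale_le => //; rewrite lef_pV2 ?posrE// ?ltW// (lt_trans u0).
have /nbhs_ballP[e /= e0 eA] : nbhs u^-1 ((fun s : R => s *: y) @^-1` A).
  apply: (@scalel_continuous R 'rV[R]_d y u^-1).
  by apply: open_nbhs_nbhs; split=> //; exact: scrR_open.
have ui0 : 0 < u^-1 by rewrite invr_gt0.
(* The minimum keeps the shifted factor s positive as well as within e. *)
set s := u^-1 - Num.min e u^-1 / 2.
have m0 : 0 < Num.min e u^-1 by rewrite lt_min e0.
have mu : Num.min e u^-1 <= u^-1 by rewrite ge_min lexx orbT.
have me : Num.min e u^-1 <= e by rewrite ge_min lexx.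
have s0 : 0 < s by rewrite /s; lra.
exists s^-1; first by rewrite -[ltLHS]invrK ltf_pV2 ?posrE// /s; lra.
rewrite invrK; apply: eA; rewrite -ball_normE /= /s subKr.
by rewrite gtr0_norm; lra.
Qed.

(** If every point d y_i e_i were in the complement of A, so would be their
    mean y. *)
Lemma scrR_coordinate y : A y ->
  exists i : 'I_d, A (d%:R *: (y ord0 i *: delta_mx ord0 i)).
Proof.
case: d A hA y => [|n] B hB y By.
  case: (scrR_notin0 hB); apply: subset_closure.
  by have -> : 0 = y by apply/rowP => -[].
apply: contrapT => /forallNP nB.
have : (~` B) (n.+1%:R^-1 *: \sum_i (n.+1%:R *: (y ord0 i *: delta_mx ord0 i))).
  by apply: convex_set_mean => //; exact: scrR_convexC.
by rewrite -scaler_sumr scalerK ?pnatr_eq0// -row_sum_delta; apply.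
Qed.

End scrR_geometry.

(** * Measurability in R^d *)

Lemma measurable_open_rvec (R : realType) (d : nat) (U : set 'rV[R]_d) :
  open U -> measurable (U : set (rvec R d)).
Proof. exact: sub_sigma_algebra. Qed.

Lemma measurable_coordinate (R : realType) (d : nat) (i : 'I_d) :
  measurable_fun setT (fun x : rvec R d => (x : 'rV[R]_d) ord0 i).
Proof.
apply: (measurability _ (RGenOInfty.measurableE R)).
move=> _ [_ [a ->] <-]; rewrite setTI; apply: measurable_open_rvec.
by apply: open_comp => [x _|]; [exact: coord_continuous|exact: interval_open].
Qed.

(** R^d is second countable: an open set is the union of the open boxes with
    rational centre and radius 1/(n+1) that it contains, and the preimage of a
    box is a finite intersection of coordinate events. *)
Lemma measurable_preimage_open (R : realType) (d : nat) (disp : measure_display)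
    (T : measurableType disp) (Z : T -> 'rV[R]_d) (U : set 'rV[R]_d) :
  (forall i, measurable_fun setT (fun t => Z t ord0 i)) -> open U ->
  measurable (Z @^-1` U).
Proof.
move=> mZ oU.
pose box (q : 'rV[rat]_d * nat) : set 'rV[R]_d :=
  [set y | forall i, `|ratr (q.1 ord0 i) - y ord0 i| < q.2.+1%:R^-1].
have mbox q : measurable (Z @^-1` box q).
  rewrite (_ : _ @^-1` _ = \bigcap_(i in [set: 'I_d])
      (fun t => Z t ord0 i) @^-1` ball (ratr (q.1 ord0 i) : R) q.2.+1%:R^-1).
    apply: fin_bigcap_measurable => // i _.
    by rewrite -[X in measurable X]setTI; apply: mZ => //; exact: measurable_ball.
  apply/seteqP; split=> t h i; first by move=> _ /=; rewrite -ball_normE; exact: h.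
  by have := h i I; rewrite /= -ball_normE.
rewrite (_ : Z @^-1` U = \bigcup_q (if `[< box q `<=` U >] then Z @^-1` box q else set0)).
  apply: countable_bigcupT_measurable => // q.
  by case: ifP.
apply/seteqP; split=> [t UZt|t [q _]]; last by case: asboolP => // qU /qU.
have /nbhs_ballP[e /= e0 eU] : nbhs (Z t) U by exact: open_nbhs_nbhs.
have [n ne] : exists n, 0 + n.+1%:R^-1 < e / 2 by apply: ltr_add_invr; rewrite divr_gt0.
rewrite add0r in ne; have n0 : 0 < (n.+1%:R : R)^-1 by rewrite invr_gt0.
have q_ i : {q : rat | ratr q \in `]Z t ord0 i, (Z t ord0 i + n.+1%:R^-1)[}.
  by apply: cid; apply: rat_in_itvoo; rewrite ltrDl.
have Zbox : box (\row_i sval (q_ i), n) (Z t).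
  move=> i /=; rewrite mxE; case: (q_ i) => /= q; rewrite in_itv /= => /andP[q1 q2].
  by rewrite gtr0_norm ?subr_gt0// ltrBlDl.
exists (\row_i sval (q_ i), n) => //; case: asboolP => // -[] y ybox.
apply: eU; split=> // j i; rewrite (ord1 j) -ball_normE /=.
have := ybox i; have := Zbox i => /=; rewrite mxE.
set r := ratr _ => h1 h2; rewrite -(subrKA r) (le_lt_trans (ler_normD _ _))//.
by move: h1 h2 ne; rewrite distrC; move: (n.+1%:R^-1) => s; lra.
Qed.

(** * Probabilities as real numbers *)

Section real_probability.
Variables (R : realType) (disp : measure_display) (T : measurableType disp).
Variable P : probability T R.
Implicit Types (B C : set T).

Definition pr (B : set T) : R := fine (P B).

Lemma prE B : measurable B -> P B = (pr B)%:E.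
Proof. by move=> mB; rewrite /pr fineK// fin_num_measure. Qed.

Lemma pr_ge0 B : 0 <= pr B.
Proof. by rewrite /pr fine_ge0. Qed.

Lemma pr_le B C : measurable B -> measurable C -> B `<=` C -> pr B <= pr C.
Proof.
move=> mB mC BC; rewrite -lee_fin -!prE//.
by apply: le_measure => //; rewrite inE.
Qed.

Lemma pr_setU B C : measurable B -> measurable C -> pr (B `|` C) <= pr B + pr C.
Proof.
move=> mB mC; rewrite -lee_fin EFinD -!prE//; last exact: measurableU.
exact: measureU2.
Qed.

Lemma pr_exists (I : finType) (B : set T) (E : I -> set T) :
  measurable B -> (forall i, measurable (E i)) ->
  (forall t, B t -> exists i, E i t) -> pr B <= \sum_i pr (E i).
Proof.
move=> mB mE BE.
apply: (@le_trans _ _ (pr (\big[setU/set0]_i E i))).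
  apply: pr_le => //; first exact: bigsetU_measurable.
  by move=> t /BE[i Et]; rewrite (bigD1 i)//=; left.
elim: (index_enum I) => [|i r IHr]; first by rewrite !big_nil /pr measure0.
rewrite !big_cons; apply: le_trans (pr_setU _ _) _ => //.
  exact: bigsetU_measurable.
by rewrite lerD2l.
Qed.

Lemma measurable_superlevel (f : T -> R) (a : R) :
  measurable_fun setT f -> measurable [set t | a < f t].
Proof.
move=> mf; rewrite -[X in measurable X]setTI.
by rewrite -[[set t | _]]/(f @^-1` [set y | a < y]) -set_itvoy; exact: mf.
Qed.

(** Continuity from below: the events f > 1/(n+1) exhaust f > 0. *)
Lemma exists_pr_gt (f : T -> R) : measurable_fun setT f -> (forall t, 0 <= f t) ->
  P [set t | f t = 0] <> 1%E -> exists2 e : R, 0 < e & 0 < pr [set t | e < f t].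
Proof.
move=> mf f0 nd.
have mgt a : measurable [set t | a < f t] by exact: measurable_superlevel.
apply: contrapT => /forall2NP none; apply: nd.
rewrite (_ : [set t | _] = ~` [set t | 0 < f t]); last first.
  apply/seteqP; split=> t /= => [->|/negP]; first by rewrite ltxx.
  by rewrite -leNgt => ft; apply/eqP; rewrite eq_le ft f0.
suff P0 : P [set t | 0 < f t] = 0%E by rewrite probability_setC// P0 sube0.
apply/negligibleP => //.
have -> : [set t | 0 < f t] = \bigcup_n [set t | n.+1%:R^-1 < f t].
  apply/seteqP; split=> t /= => [ft|[n _ /=]].
    by have [n] := ltr_add_invr ft; rewrite add0r => nt; exists n.
  by apply: le_lt_trans; rewrite invr_ge0.
apply: negligible_bigcup => n; apply/negligibleP => //.
have n0 : 0 < (n.+1%:R : R)^-1 by rewrite invr_gt0.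
have [/(_ n0)//|/negP] := none (n.+1%:R^-1).
rewrite -leNgt => p0; apply: etrans (prE (mgt _)) _.
by congr EFin; apply/eqP; rewrite eq_le p0 pr_ge0.
Qed.

Lemma pr_markov_powR (f : T -> R) (p : R) : 0 < p ->
  measurable_fun setT f -> (forall t, 0 <= f t) ->
  ('E_P[fun t => (f t `^ p)%R] < +oo)%E ->
  exists2 m : R, 0 <= m & forall s : R, 0 < s -> pr [set t | s < f t] * s `^ p <= m.
Proof.
move=> p0 mf f0 Efin.
have mgt a : measurable [set t | a < f t] by exact: measurable_superlevel.
have mfp : measurable_fun setT (fun t => f t `^ p).
  exact: (measurableT_comp (measurable_powR p)).
have E0 : (0 <= 'E_P[fun t => (f t `^ p)%R])%E.
  by apply: expectation_ge0 => t; exact: powR_ge0.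
have Efn : 'E_P[fun t => (f t `^ p)%R]%E \is a fin_num by rewrite ge0_fin_numE.
exists (fine 'E_P[fun t => (f t `^ p)%R]); first exact: fine_ge0.
move=> s s0; rewrite -lee_fin fineK// EFinM -prE// muleC.
apply: (@le_trans _ _ (\int[P]_t `|(f t `^ p)%:E|)%E); last first.
  rewrite unlock le_eqVlt; apply/orP; left; apply/eqP; apply: eq_integral => t _.
  by rewrite gee0_abs// lee_fin powR_ge0.
have sp0 : 0 < s `^ p by exact: powR_gt0.
have mE : measurable_fun setT (fun t => (f t `^ p)%:E) by exact/measurable_EFinP.
have := @le_integral_comp_abse _ _ _ P setT measurableT
  (fun t => (f t `^ p)%:E) (s `^ p) id (@measurable_id _ _ _) _ _ mE sp0.
move=> /(_ (fun r h => h) (fun x y _ _ h => h)); apply: le_trans.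
rewrite lee_pmul2l//; apply: le_measure; rewrite ?inE//.
  apply: emeasurable_fun_c_infty => //; exact: measurableT_comp.
move=> t /= sf; split=> //=; rewrite lee_fin ger0_norm ?powR_ge0//.
by rewrite ge0_ler_powR ?nnegrE// ltW.
Qed.

Lemma pr_some_gt_powR (I : finType)
    (f : I -> T -> R) (p : R) : 0 < p ->
  (forall i, measurable_fun setT (f i)) -> (forall i t, 0 <= f i t) ->
  (forall i, 'E_P[fun t => (f i t `^ p)%R] < +oo)%E ->
  exists2 m : R, 0 <= m &
    forall s, 0 < s -> pr [set t | exists i, s < f i t] * s `^ p <= m.
Proof.
move=> p0 mf f0 Ef.
have [m m0 mP] : exists2 m : I -> R, (forall i, 0 <= m i) &
    forall i s, 0 < s -> pr [set t | s < f i t] * s `^ p <= m i.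
  have H i := cid2 (@pr_markov_powR _ _ p0 (mf i) (f0 i) (Ef i)).
  by exists (fun i => s2val (H i)) => i; [exact: (s2valP (H i))|exact: (s2valP' (H i))].
have mgt i a : measurable [set t | a < f i t] by exact: measurable_superlevel.
exists (\sum_i m i) => [|s s0]; first exact: sumr_ge0.
apply: (@le_trans _ _ ((\sum_i pr [set t | s < f i t]) * s `^ p)).
  rewrite ler_wpM2r ?powR_ge0//; apply: pr_exists => //.
  rewrite (_ : [set t | _] = \bigcup_(i in [set: I]) [set t | s < f i t]).
    exact: fin_bigcup_measurable.
  by apply/seteqP; split=> t /= => [[i it]|[i _ it]]; exists i.
by rewrite mulr_suml; apply: ler_sum => i _; exact: mP.
Qed.

End real_probability.

(** * Tails along A and the two bounds *)

Section tail_along.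
Variables (R : realType) (d : nat) (A : set 'rV[R]_d).
Hypothesis hA : in_scrR A.
Variables (disp : measure_display) (T : measurableType disp) (P : probability T R).

(** The event Z in xA is [exceed Z x^-1]: indexing by the multiplier u = 1/x
    keeps it the preimage of an open set for every u. *)
Definition exceed (Z : T -> 'rV[R]_d) (u : R) : set T := [set t | A (u *: Z t)].

Lemma open_scrR_scale (u : R) : open [set y : 'rV[R]_d | A (u *: y)].
Proof.
rewrite -[X in open X]/(( *:%R u) @^-1` A).
by apply: open_comp; [move=> y _; exact: scaler_continuous|exact: scrR_open].
Qed.

Variable Z : T -> 'rV[R]_d.
Hypothesis mZ : forall i, measurable_fun setT (fun t => Z t ord0 i).
Hypothesis Z0 : forall t, nonneg_vec (Z t).

Lemma measurable_exceed u : measurable (exceed Z u).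
Proof. exact: (measurable_preimage_open mZ (@open_scrR_scale u)). Qed.

Let law := law_along A (pushforward P (Z : T -> rvec R d)).

Lemma tail_law_along u : 0 < u -> tail law u = pr P (exceed Z u^-1).
Proof.
move=> u0; rewrite /tail /pr /law /law_along /pushforward /=.
congr (fine (P _)); apply/seteqP; split=> t /=.
  by rewrite in_itv /= andbT => /(Yfun_gt_scale hA u0 (Z0 t)).
by move=> At; rewrite in_itv /= andbT; apply/(Yfun_gt_scale hA u0 (Z0 t)).
Qed.

(** The point x = 0 has to be covered too, where the event Y_A > x is not of the
    form Z in xA; as a union over u > x of the events Z in uA it is the preimage
    of an open set for all x >= 0. *)
Lemma tail_law_along_noninc x y : 0 <= x -> x <= y -> tail law y <= tail law x.
Proof.
have tailE w : 0 <= w -> tail law w =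
    pr P (Z @^-1` \bigcup_(u in [set u | w < u]) [set y | A (u^-1 *: y)]).
  move=> w0; rewrite /tail /pr /law /law_along /pushforward /=.
  congr (fine (P _)); apply/seteqP; split=> t /=.
    by rewrite in_itv /= andbT => /(Yfun_gt hA w0 (Z0 t))[u wu Au]; exists u.
  move=> [u wu Au]; rewrite in_itv /= andbT; apply/(Yfun_gt hA w0 (Z0 t)).
  by exists u.
have mtail w : measurable
    (Z @^-1` \bigcup_(u in [set u | w < u]) [set y | A (u^-1 *: y)]).
  apply: measurable_preimage_open => //; apply: bigcup_open => u _.
  exact: open_scrR_scale.
move=> x0 xy; rewrite !tailE//; last exact: le_trans xy.
apply: pr_le => // t [u yu Au]; exists u => //.
exact: le_lt_trans xy yu.
Qed.

Lemma fine_scale_set u : 0 < u ->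
  fine (pushforward P (Z : T -> rvec R d) (scale_set u A)) = pr P (exceed Z u^-1).
Proof.
move=> u0; rewrite /pushforward /pr; congr (fine (P _)).
by apply/funext => t /=; rewrite /preimage /= scale_setE.
Qed.

End tail_along.

Section product.
Variables (R : realType) (d : nat) (A : set 'rV[R]_d).
Hypothesis hA : in_scrR A.
Variables (disp : measure_display) (T : measurableType disp) (P : probability T R).
Variables X Theta : {RV P >-> rvec R d}.
Hypothesis X0 : forall t, nonneg_vec (X t : 'rV[R]_d).
Hypothesis Theta0 : forall t, nonneg_vec (Theta t : 'rV[R]_d).
Hypothesis indep : independent_rv P Theta X.

Let ThetaX (t : T) : 'rV[R]_d := vprod (Theta t) (X t).
Let F (x : R) := pr P (exceed A X x^-1).
Let H (x : R) := pr P (exceed A ThetaX x^-1).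

Lemma measurable_RV_open (Z : {RV P >-> rvec R d}) (U : set 'rV[R]_d) :
  open U -> measurable ((Z : T -> 'rV[R]_d) @^-1` U).
Proof.
move=> /measurable_open_rvec mU; rewrite -[X in measurable X]setTI.
exact: measurable_funPT mU.
Qed.

Lemma measurable_RV_coordinate (Z : {RV P >-> rvec R d}) i :
  measurable_fun setT (fun t => (Z t : 'rV[R]_d) ord0 i).
Proof.
exact: (measurableT_comp (@measurable_coordinate R d i) (measurable_funPT Z)).
Qed.

Lemma measurable_vprod_coordinate i :
  measurable_fun setT (fun t => ThetaX t ord0 i).
Proof.
rewrite (_ : (fun t => _) = (fun t => (Theta t : 'rV[R]_d) ord0 i) \*
   (fun t => (X t : 'rV[R]_d) ord0 i)); last by apply/funext => t; rewrite mxE.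
by apply: measurable_funM; exact: measurable_RV_coordinate.
Qed.

Lemma vprod_ge0 t : nonneg_vec (ThetaX t).
Proof.
by move=> i; rewrite mxE mulr_ge0//; [exact: Theta0|exact: X0].
Qed.

Lemma pr_indep (B C : set 'rV[R]_d) : open B -> open C ->
  pr P ((Theta : T -> 'rV[R]_d) @^-1` B `&` (X : T -> 'rV[R]_d) @^-1` C) =
  pr P ((Theta : T -> 'rV[R]_d) @^-1` B) * pr P ((X : T -> 'rV[R]_d) @^-1` C).
Proof.
move=> oB oC; have mB := measurable_open_rvec oB; have mC := measurable_open_rvec oC.
have mTB := measurable_RV_open Theta oB; have mXC := measurable_RV_open X oC.
have /= := indep mB mC; rewrite !(prE P)//; last exact: measurableI.
by rewrite -EFinM => -[].
Qed.

Lemma open_coordinate_gt (i : 'I_d) (s : R) : open [set y : 'rV[R]_d | s < y ord0 i].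
Proof.
rewrite -[X in open X]/((fun y : 'rV[R]_d => y ord0 i) @^-1` [set z | s < z]).
by apply: open_comp; [move=> y _; exact: coord_continuous|exact: open_gt].
Qed.

Let someTheta_gt (s : R) : set T := [set t | exists i, s < (Theta t : 'rV[R]_d) ord0 i].
Let Theta_le (s : R) : set T := [set t | forall i, (Theta t : 'rV[R]_d) ord0 i <= s].

Lemma open_some_coordinate_gt (s : R) :
  open [set y : 'rV[R]_d | exists i, s < y ord0 i].
Proof.
rewrite (_ : [set y | _] = \bigcup_i [set y : 'rV[R]_d | s < y ord0 i]).
  by apply: bigcup_open => i _; exact: open_coordinate_gt.
by apply/seteqP; split=> y /= => [[i iy]|[i _ iy]]; exists i.
Qed.

Lemma measurable_some_gt s : measurable (someTheta_gt s).
Proof.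
exact: (measurable_RV_open Theta (@open_some_coordinate_gt s)).
Qed.

Lemma Theta_leE s : Theta_le s = ~` someTheta_gt s.
Proof.
apply/seteqP; split=> t /= => [le [i]|ngt i]; first by rewrite ltNge le.
by rewrite leNgt; apply/negP => lt; apply: ngt; exists i.
Qed.

Lemma measurable_Theta_le s : measurable (Theta_le s).
Proof. by rewrite Theta_leE; apply: measurableC; exact: measurable_some_gt. Qed.

(** Monotonicity of A: on the event that all Theta_i <= s, the product is
    dominated componentwise by s X. *)
Lemma exceed_vprod_le (x s : R) t : 0 < x -> Theta_le s t ->
  exceed A ThetaX x^-1 t -> exceed A X (x / s)^-1 t.
Proof.
move=> x0 st; rewrite /exceed /= => Ax; apply: (scrR_le hA Ax) => i.
rewrite !mxE invf_div [s / x]mulrC -mulrA.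
rewrite ler_wpM2l ?invr_ge0 ?(ltW x0)// ler_wpM2r//; exact: X0.
Qed.

Let mThetaX u : measurable (exceed A ThetaX u).
Proof. exact: (measurable_exceed hA measurable_vprod_coordinate). Qed.

Let mX u : measurable (exceed A X u).
Proof. exact: (measurable_exceed hA (measurable_RV_coordinate X)). Qed.

(** Induction over the layers v ^ k < max_i Theta_i <= v ^ (k+1).  With
    r = rho / sigma, layer k costs at most m rho r ^ k F(x), and c is the sum of
    the series m rho r ^ k, so that c (1 - r ^ K) is its partial sum. *)
Lemma pr_vprod_layers (m v rho sigma x0 c x : R) (K : nat) :
  1 < v -> 1 <= rho -> rho < sigma -> 0 <= m -> 0 < x0 ->
  (forall k, pr P (someTheta_gt (v ^+ k)) * sigma ^+ k <= m) ->
  (forall y, x0 <= y -> F y <= rho * F (v * y)) ->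
  c * (1 - rho / sigma) = m * rho ->
  x0 * v ^+ K <= x ->
  pr P (exceed A ThetaX x^-1 `&` Theta_le (v ^+ K)) <=
    F x * (1 + c * (1 - (rho / sigma) ^+ K)).
Proof.
move=> v1 rho1 rs m0 x00 q FD cE.
have v0 : 0 < v by apply: lt_trans v1.
have rho0 : 0 < rho by apply: lt_le_trans rho1.
have sigma0 : 0 < sigma by apply: lt_trans rs.
elim: K => [|K IHK] Kx.
  rewrite expr0 mulr1 in Kx; have xp : 0 < x by apply: lt_le_trans Kx.
  rewrite !expr0 subrr mulr0 addr0 mulr1; apply: pr_le => //.
    by apply: measurableI => //; exact: measurable_Theta_le.
  by move=> t [At le1]; rewrite -[x]divr1; apply: exceed_vprod_le At.
have vK0 k : 0 < v ^+ k by rewrite exprn_gt0.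
have xp : 0 < x by apply: lt_le_trans Kx; rewrite mulr_gt0.
have F_iter k : x0 * v ^+ k <= x -> F (x / v ^+ k) <= rho ^+ k * F x.
  by apply: tail_ratio_iter => //; exact: ltW.
have split_layer : pr P (exceed A ThetaX x^-1 `&` Theta_le (v ^+ K.+1)) <=
    pr P (exceed A ThetaX x^-1 `&` Theta_le (v ^+ K)) +
    pr P (someTheta_gt (v ^+ K)) * F (x / v ^+ K.+1).
  have -> : pr P (someTheta_gt (v ^+ K)) * F (x / v ^+ K.+1) =
      pr P (someTheta_gt (v ^+ K) `&` exceed A X (x / v ^+ K.+1)^-1).
    by rewrite -(pr_indep (@open_some_coordinate_gt _) (@open_scrR_scale _ _ _ hA _)).
  apply: le_trans (pr_setU _ _ _); first apply: pr_le.
  - by apply: measurableI => //; exact: measurable_Theta_le.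
  - apply: measurableU; apply: measurableI => //; first exact: measurable_Theta_le.
    exact: measurable_some_gt.
  - move=> t [At le]; have [leK|] := pselect (Theta_le (v ^+ K) t); first by left.
    rewrite Theta_leE => /contrapT gtK; right; split=> //.
    exact: exceed_vprod_le At.
  - by apply: measurableI => //; exact: measurable_Theta_le.
  - by apply: measurableI => //; exact: measurable_some_gt.
apply: le_trans split_layer _.
have Fx0 : 0 <= F x by exact: pr_ge0.
have IH : pr P (exceed A ThetaX x^-1 `&` Theta_le (v ^+ K)) <=
    F x * (1 + c * (1 - (rho / sigma) ^+ K)).
  by apply: IHK; apply: le_trans Kx; rewrite ler_pM2l// exprS ler_peMl// ltW.
have layer : pr P (someTheta_gt (v ^+ K)) * F (x / v ^+ K.+1) <=
    (m / sigma ^+ K) * (rho ^+ K.+1 * F x).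
  by apply: ler_pM; rewrite ?pr_ge0// ?F_iter// ler_pdivlMr// exprn_gt0.
apply: le_trans (lerD IH layer) _.
have -> : (m / sigma ^+ K) * (rho ^+ K.+1 * F x) = F x * (m * rho * (rho / sigma) ^+ K).
  by rewrite exprS expr_div_n; ring.
rewrite -cE -mulrDr ler_wpM2l// exprS le_eqVlt; apply/orP; left; apply/eqP.
by ring.
Qed.

(** K is chosen with x0 v ^ K <= x < x0 v ^ (K+1): the ratio bound may be
    iterated K times, while F (x / v ^ K) is at least the constant F (x0 v). *)
Lemma vprod_tail_upper (m v rho sigma x0 : R) :
  1 < v -> 1 <= rho -> rho < sigma -> 0 <= m -> 0 < x0 ->
  (forall k, pr P (someTheta_gt (v ^+ k)) * sigma ^+ k <= m) ->
  (forall y, x0 <= y -> F y <= rho * F (v * y)) ->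
  (forall y, 0 < y -> 0 < F y) ->
  (forall y z, 0 < y -> y <= z -> F z <= F y) ->
  exists C, forall x, x0 <= x -> H x <= C * F x.
Proof.
move=> v1 rho1 rs m0 x00 q FD Fpos Fdec.
have v0 : 0 < v by apply: lt_trans v1.
have rho0 : 0 < rho by apply: lt_le_trans rho1.
have sigma0 : 0 < sigma by apply: lt_trans rs.
have r1 : 0 < 1 - rho / sigma by rewrite subr_gt0 ltr_pdivrMr// mul1r.
have Fb : 0 < F (x0 * v) by apply: Fpos; rewrite mulr_gt0.
pose c := m * rho / (1 - rho / sigma).
have cE : c * (1 - rho / sigma) = m * rho by rewrite /c divfK// gt_eqF.
have c0 : 0 <= c by rewrite /c divr_ge0// ?mulr_ge0// ltW.
exists (1 + c + m / F (x0 * v)) => x x0x.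
have x_gt0 : 0 < x by apply: lt_le_trans x0x.
have [|K /andP[Klo Khi]] := @exists_expn_bracket _ v (x / x0) v1.
  by rewrite ler_pdivlMr// mul1r.
rewrite ler_pdivlMr// mulrC in Klo; rewrite ltr_pdivrMr// mulrC in Khi.
have vK0 : 0 < v ^+ K by rewrite exprn_gt0.
have split_top : H x <= pr P (exceed A ThetaX x^-1 `&` Theta_le (v ^+ K)) +
    pr P (someTheta_gt (v ^+ K)).
  apply: le_trans (pr_setU _ _ _); first apply: pr_le => //.
  - apply: measurableU; last exact: measurable_some_gt.
    by apply: measurableI => //; exact: measurable_Theta_le.
  - move=> t At; have [leK|] := pselect (Theta_le (v ^+ K) t); first by left.
    by rewrite Theta_leE => /contrapT gtK; right.
  - by apply: measurableI => //; exact: measurable_Theta_le.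
  - exact: measurable_some_gt.
apply: le_trans split_top _.
have layers := pr_vprod_layers v1 rho1 rs m0 x00 q FD cE Klo.
have Fx0 : 0 <= F x by exact: pr_ge0.
have last_layer : pr P (someTheta_gt (v ^+ K)) <= m / F (x0 * v) * F x.
  have := tail_ratio_iter v1 (ltW rho0) x00 FD Klo.
  have : F (x0 * v) <= F (x / v ^+ K).
    apply: Fdec; rewrite ?divr_gt0// ler_pdivrMr//.
    by rewrite -mulrA -exprS ltW.
  move=> /le_trans h /h{h}; rewrite -ler_pdivrMl ?exprn_gt0// => FK.
  apply: (@le_trans _ _ (m / rho ^+ K)).
    rewrite ler_pdivlMr ?exprn_gt0//; apply: le_trans (q K).
    by rewrite ler_wpM2l ?pr_ge0// lerXn2r ?nnegrE// ltW.
  rewrite -mulrA ler_wpM2l// [_^-1 * F x]mulrC ler_pdivlMr//.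
apply: le_trans (lerD layers last_layer) _.
rewrite mulrC -mulrDl ler_wpM2r// lerD2r lerD2l ler_piMr// lerBlDr lerDl.
by rewrite exprn_ge0// divr_ge0// ltW.
Qed.

Lemma open_axis (u : R) (i : 'I_d) :
  open [set y : 'rV[R]_d | A ((u * y ord0 i) *: delta_mx ord0 i)].
Proof.
rewrite -[X in open X]/((fun y : 'rV[R]_d => (u * y ord0 i) *: delta_mx ord0 i) @^-1` A).
apply: open_comp; last exact: scrR_open.
move=> y _; apply: (@cvg_comp _ _ _ (fun y : 'rV[R]_d => u * y ord0 i)
  (fun r => r *: delta_mx ord0 i)); last exact: scalel_continuous.
apply: (@cvg_comp _ _ _ (fun y : 'rV[R]_d => y ord0 i) (fun r => u * r));
  [exact: coord_continuous|exact: mulrl_continuous].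
Qed.

(** One axis at a time: when Theta_i > eps, the vector (u / eps) Theta X
    dominates u X_i e_i. *)
Lemma pr_axis_le (eps u : R) (i : 'I_d) : 0 < eps -> 0 <= u ->
  pr P [set t | eps < (Theta t : 'rV[R]_d) ord0 i] *
  pr P [set t | A ((u * (X t : 'rV[R]_d) ord0 i) *: delta_mx ord0 i)]
  <= pr P (exceed A ThetaX (u / eps)).
Proof.
move=> eps0 u0; rewrite -(pr_indep (@open_coordinate_gt _ _) (@open_axis _ _)).
apply: pr_le => //; first apply: measurableI.
- exact: (measurable_RV_open Theta (@open_coordinate_gt _ _)).
- exact: (measurable_RV_open X (@open_axis _ _)).
move=> t [/= epsT]; rewrite /exceed /= => At; apply: (scrR_le hA At) => j.
rewrite !mxE eqxx /=; have [->|_] := eqVneq.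
  rewrite mulr1 -!mulrA ler_wpM2l// mulrA ler_peMl//; first exact: X0.
  by rewrite mulrC ler_pdivlMr// mul1r ltW.
by rewrite mulr0 !mulr_ge0 ?invr_ge0 ?(ltW eps0)//; [exact: Theta0|exact: X0].
Qed.

(** A single e serves as threshold for every Theta_i and as lower bound for the
    probabilities of exceeding it: both requirements hold for all small e > 0,
    and there are finitely many components. *)
Lemma vprod_tail_lower : (0 < d)%N ->
  (forall i : 'I_d, P [set t | (Theta t : 'rV[R]_d) ord0 i = 0] <> 1%E) ->
  exists b c : R, [/\ 0 < b < 1, 0 < c & forall x, 0 < x -> c * F x <= H (b * x)].
Proof.
move=> d0 nd; have dr0 : 0 < d%:R :> R by rewrite ltr0n.
have mgt (i : 'I_d) (e : R) : measurable [set t | e < (Theta t : 'rV[R]_d) ord0 i].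
  exact: (measurable_RV_open Theta (@open_coordinate_gt _ _)).
have near0 : \forall e \near (0 : R)^'+,
    forall i : 'I_d, e < pr P [set t | e < (Theta t : 'rV[R]_d) ord0 i].
  apply: filter_forall => i.
  have [||e e0 pe] := @exists_pr_gt _ _ _ P (fun t => (Theta t : 'rV[R]_d) ord0 i) _ _ (nd i).
  - exact: measurable_RV_coordinate.
  - by move=> t; exact: Theta0.
  near=> s.
  have se : s < e by near: s; exact: nbhs_right_lt.
  apply: (@lt_le_trans _ _ (pr P [set t | e < (Theta t : 'rV[R]_d) ord0 i])).
    by near: s; exact: nbhs_right_lt.
  by apply: pr_le => // t /=; exact: lt_trans.
have [e [e0 [e1 pe]]] : exists e : R, 0 < e /\ e < 1 /\
    forall i : 'I_d, e < pr P [set t | e < (Theta t : 'rV[R]_d) ord0 i].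
  apply: (@filter_ex _ (0 : R)^'+); near=> e; split; last split.
  - by near: e; exact: nbhs_right_gt.
  - by near: e; exact: nbhs_right_lt.
  - by near: e.
exists (e / d%:R), (e / d%:R); split; first 1 last.
- exact: divr_gt0.
- move=> x x0; rewrite mulrAC ler_pdivrMr//.
  pose axis i := [set t | A ((d%:R / x * (X t : 'rV[R]_d) ord0 i) *: delta_mx ord0 i)].
  have FX : F x <= \sum_i pr P (axis i).
    apply: pr_exists => // [i|t At].
      exact: (measurable_RV_open X (@open_axis _ _)).
    have [i Ai] := scrR_coordinate hA At; exists i; rewrite /axis /=.
    by move: Ai; rewrite mxE !scalerA !mulrA.
  apply: le_trans (ler_wpM2l (ltW e0) FX) _; rewrite mulr_sumr.
  rewrite mulr_natr -[X in _ *+ X]card_ord -sumr_const; apply: ler_sum => i _.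
  have -> : H (e / d%:R * x) = pr P (exceed A ThetaX (d%:R / x / e)).
    by congr (pr _ (exceed _ _ _)); field; rewrite !gt_eqF.
  apply: le_trans (pr_axis_le i e0 _); last by rewrite divr_ge0// ltW.
  by rewrite ler_wpM2r ?pr_ge0// ltW.
- rewrite divr_gt0//= ltr_pdivrMr// mul1r (lt_le_trans e1)//.
  by rewrite ler1n.
Unshelve. all: by end_near. Qed.

End product.

(** * Dominated variation of the product *)

Theorem theorem3p1 (R : realType) (d : nat) (hd : (0 < d)%N)
    (A : set 'rV[R]_d) (hA : in_scrR A)
    (disp : measure_display) (T : measurableType disp) (P : probability T R)
    (X Theta : {RV P >-> rvec R d})
    (X_ge0 : forall t, nonneg_vec (X t : 'rV[R]_d))
    (Theta_ge0 : forall t, nonneg_vec (Theta t : 'rV[R]_d))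
    (F_D : dominatedly_varying_along A (distribution P X))
    (Theta_nondeg : forall i : 'I_d,
       P [set t | (Theta t : 'rV[R]_d) ord0 i = 0] <> 1%E)
    (indep : independent_rv P Theta X)
    (p : R)
    (hp : (upper_Matuszewska (law_along A (distribution P X)) < p%:E)%E)
    (Theta_moment : forall i : 'I_d,
       ('E_P[fun t => ((Theta t : 'rV[R]_d) ord0 i `^ p)%R] < +oo)%E) :
  let F : set (rvec R d) -> \bar R := distribution P X in
  let H : set (rvec R d) -> \bar R :=
    pushforward P (fun t => vprod (Theta t) (X t) : rvec R d) in
  dominatedly_varying_along A H /\
  asymp_equiv (fun x : R => fine (H (scale_set x A)))
              (fun x : R => fine (F (scale_set x A))).
Proof.
move=> F H.
have mX := measurable_RV_coordinate X.
have mTX := measurable_vprod_coordinate X Theta.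
have TX0 := vprod_ge0 X_ge0 Theta_ge0.
pose f x := pr P (exceed A X x^-1).
pose h x := pr P (exceed A (fun t => vprod (Theta t) (X t)) x^-1).
pose VF := law_along A F; pose VH := law_along A H.
have tF x : 0 < x -> tail VF x = f x by exact: (tail_law_along hA P X_ge0).
have tH x : 0 < x -> tail VH x = h x by exact: (tail_law_along hA P TX0).
have VF_dec x y : 0 <= x -> x <= y -> tail VF y <= tail VF x.
  exact: (tail_law_along_noninc hA P mX X_ge0).
have VH_dec x y : 0 <= x -> x <= y -> tail VH y <= tail VH x.
  exact: (tail_law_along_noninc hA P mTX TX0).
have VF_gt0 : forall x, 0 <= x -> 0 < tail VF x by case: F_D.
have [v [rho [x0 [v1 rho1 rhov x00 VFD]]]] := upper_Matuszewska_lt VF_gt0 VF_dec hp.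
have v0 : 0 < v by apply: lt_trans v1.
have p0 : 0 < p.
  have : 1 < v `^ p by apply: le_lt_trans rhov.
  by rewrite -ltr_ln ?posrE ?powR_gt0// ln1 ln_powR pmulr_lgt0// ln_gt0.
have [m m0 mP] := pr_some_gt_powR p0 (measurable_RV_coordinate Theta)
  (fun i t => Theta_ge0 t i) Theta_moment.
have f_gt0 x : 0 < x -> 0 < f x by move=> xp; rewrite -tF// VF_gt0// ltW.
have f_dec x y : 0 < x -> x <= y -> f y <= f x.
  move=> xp xy; rewrite -!tF ?(lt_le_trans xp)//.
  by apply: VF_dec => //; exact: ltW.
have f_ratio x : x0 <= x -> f x <= rho * f (v * x).
  move=> x0x; have xp : 0 < x by apply: lt_le_trans x0x.
  by rewrite -!tF ?mulr_gt0//; exact: VFD.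
have [C hC] : exists C, forall x, x0 <= x -> h x <= C * f x.
  apply: (vprod_tail_upper hA X_ge0 indep v1 rho1 rhov m0 x00).
  - move=> k; have -> : (v `^ p) ^+ k = (v ^+ k) `^ p.
      rewrite -(powR_mulrn _ (powR_ge0 _ _)) -powRrM mulrC powRrM.
      by rewrite powR_mulrn// ltW.
    by apply: mP; rewrite exprn_gt0.
  - exact: f_ratio.
  - exact: f_gt0.
  - exact: f_dec.
have [b [c [b01 c0 hc]]] := vprod_tail_lower hA X_ge0 Theta_ge0 indep hd Theta_nondeg.
have {}hc x : 0 < x -> c * f x <= h (b * x) by exact: hc.
have [b0 b1] := andP b01.
have [M M0 nearM] := dominatedly_varying_ratio F_D b01.
have h_gt0 x : 0 < x -> 0 < h x.
  move=> xp; have := hc (x / b) (divr_gt0 xp b0).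
  rewrite [b * _]mulrC divfK ?gt_eqF//; apply: lt_le_trans.
  by rewrite mulr_gt0// f_gt0// divr_gt0.
have C0 : 0 < C.
  have := lt_le_trans (h_gt0 _ x00) (hC _ (lexx x0)).
  by rewrite pmulr_lgt0// f_gt0.
have lower : \forall x \near +oo, f x <= M / c * h x.
  have bi0 : 0 < b^-1 by rewrite invr_gt0.
  have nearMb := near_pinfty_scale bi0 nearM.
  near=> x.
  have xp : 0 < x by near: x; apply: nbhs_pinfty_gt; rewrite num_real.
  have bx : b * (b^-1 * x) = x by rewrite mulVKf// gt_eqF.
  have := hc (b^-1 * x) (mulr_gt0 bi0 xp); rewrite bx.
  have : f x <= M * f (b^-1 * x).
    rewrite -!tF ?mulr_gt0// -{1}bx.
    by near: x.
  move=> fM ch; apply: le_trans fM _.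
  by rewrite -mulrA ler_pM2l// ler_pdivlMl.
have upper : \forall x \near +oo, h x <= C * f x.
  near=> x; apply: hC.
  by near: x; apply: nbhs_pinfty_ge; rewrite num_real.
split.
- split=> [x|].
    rewrite le_eqVlt => /predU1P[<-|xp]; last by rewrite -/VH tH// h_gt0.
    by apply: lt_le_trans (VH_dec 0 1 _ _) => //; rewrite tH// h_gt0.
  move=> b' b'01; have [b'0 b'1] := andP b'01.
  have [M' M'0 nearM'] := dominatedly_varying_ratio F_D b'01.
  apply: (@le_lt_trans _ _ (C * M' * (M / c))%:E); last by rewrite ltry.
  apply: limf_esup_pinfty_le.
  have upper' := near_pinfty_scale b'0 upper.
  near=> x.
  have xp : 0 < x by near: x; apply: nbhs_pinfty_gt; rewrite num_real.
  rewrite lee_fin -/VH !tH ?mulr_gt0// ler_pdivrMr ?h_gt0//.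
  apply: (@le_trans _ _ (C * f (b' * x))); first by near: x.
  rewrite -!mulrA ler_pM2l//.
  apply: (@le_trans _ _ (M' * f x)).
    by rewrite -!tF ?mulr_gt0//; near: x.
  by rewrite ler_pM2l// mulrA; near: x.
have HE x : 0 < x -> fine (H (scale_set x A)) = h x.
  by move=> xp; exact: fine_scale_set.
have FE x : 0 < x -> fine (F (scale_set x A)) = f x.
  by move=> xp; exact: fine_scale_set.
split; apply/eqO_exP.
- exists C => //; near=> x.
  have xp : 0 < x by near: x; apply: nbhs_pinfty_gt; rewrite num_real.
  rewrite HE// FE// !gtr0_norm ?h_gt0 ?f_gt0//.
  by near: x.
- exists (M / c); first exact: divr_gt0.
  near=> x.
  have xp : 0 < x by near: x; apply: nbhs_pinfty_gt; rewrite num_real.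
  rewrite HE// FE// !gtr0_norm ?h_gt0 ?f_gt0//.
  by near: x.
Unshelve. all: by end_near. Qed.
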